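(* The contravariant functors $\mathcal{F}$ and $\mathcal{C}$ between the category $\mathsf{mOL}$ of monadic ortholattices and the category $\mathsf{mOS}$ of monadic orthospaces form an adjunction $\mathcal{F}\dashv\mathcal{C}$ between $\mathsf{mOL}$ and $\mathsf{mOS}^{op}$; that is, $\mathcal{F}:\mathsf{mOL}\to\mathsf{mOS}^{op}$ is left adjoint to $\mathcal{C}:\mathsf{mOS}^{op}\to\mathsf{mOL}$, with bijections $\mathrm{Hom}_{\mathsf{mOL}}(L,\mathcal{C}(X))\cong\mathrm{Hom}_{\mathsf{mOS}}(X,\mathcal{F}(L))$ natural in $L$ and $X$.
   Context: An ortholattice is a bounded lattice with an order-inverting complementation $'$ of period two. A monadic ortholattice is an ortholattice with a quantifier $\exists$, i.e. a closure operator (order preserving, $a\le\exists a$, $\exists\exists a=\exists a$) such that the orthocomplement of each closed element is closed. $\mathsf{mOL}$ is the category of monadic ortholattices and homomorphisms (ortholattice homomorphisms preserving $\exists$). An orthoframe is a set $X$ with an irreflexive symmetric relation $\perp$. For $S\subseteq X$, $S^\perp=\{y\in X:x\perp y\text{ for all }x\in S\}$; $S$ is bi-orthogonally closed if $S=S^{\perp\perp}$. For a binary relation $R$ on $X$ and $A\subseteq X$, $R[A]=\{y\in X:x\,R\,y\text{ for some }x\in A\}$. A monadic orthoframe is $(X,\perp,R)$ with $(X,\perp)$ an orthoframe and $R$ reflexive, transitive, with $R[R[\{x\}]^\perp]\subseteq R[\{x\}]^\perp$ for all $x\in X$. An orthospace $(X,\perp,\le,\tau)$ is an orthoframe $(X,\perp)$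 with a partial ordering $\le$ and a compact topology $\tau$ such that, writing $\mathcal{C}(X)$ for the set of clopen bi-orthogonally closed subsets of $X$: (1) if $x\nleq y$ then there is $U\in\mathcal{C}(X)$ with $x\in U$, $y\notin U$; (2) if $x\perp z$ and $x\le y$ then $y\perp z$; (3) if $U\in\mathcal{C}(X)$ then $U^\perp\in\mathcal{C}(X)$; (4) if $x\perp y$ then there is $U\in\mathcal{C}(X)$ with $x\in U$, $y\in U^\perp$. An orthospace morphism $\phi:P\to X$ is a continuous map such that: if $\phi(p)\perp\phi(q)$ then $p\perp q$; and if $x\not\perp\phi(p)$ then there exists $q$ with $q\not\perp p$ and $\phi(q)\in\{x\}^{\perp\perp}$. A monadic orthospace $(X,\perp,\le,R,\tau)$ is such that $(X,\perp,\le,\tau)$ is an orthospace, $(X,\perp,R)$ is a monadic orthoframe, and $R[U]\in\mathcal{C}(X)$ for each $U\in\mathcal{C}(X)$. A monadic orthospace morphism $\phi:X\to Y$ is an orthospace morphism with $R[\phi^{-1}[U]]=\phi^{-1}[R[U]]$ for each $U\in\mathcal{C}(Y)$ (with $R$ denoting the relation of $X$, respectively of $Y$). $\mathsf{mOS}$ is the category of monadic orthospaces and their morphisms. For a monadic ortholattice $L$, $\mathcal{F}(L)$ is the monadic orthospace of proper non-empty filters of $L$, with $x\perp y$ iff there is a non-zero $a\in L$ with $a\in x$ and $a'\in y$, ordered by inclusion, with topology having as sub-basis the sets $\{x:a\in x\}$ ($a\in L$) and their set-theoretic complements, and $x\,R\,y$ iff $\exists[x]\subseteq y$, where $\exists[x]=\{\exists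 a:a\in x\}$. For a monadic orthospace $X$, $\mathcal{C}(X)$ is the monadic ortholattice of clopen bi-orthogonally closed subsets ordered by inclusion with orthocomplement $U\mapsto U^\perp$ (meets are intersections, $U\vee V=(U\cup V)^{\perp\perp}$) and quantifier $\exists U=R[U]^{\perp\perp}$. On morphisms, $\mathcal{F}(f)=f^{-1}[\,\cdot\,]$ and $\mathcal{C}(\phi)=\phi^{-1}[\,\cdot\,]$. *)

(* Defs.v *)
From HB Require Import structures.
From mathcomp Require Import all_boot all_order.
From mathcomp Require Import finmap.
From mathcomp Require Import boolp classical_sets functions filter topology.

Set Implicit Arguments.
Unset Strict Implicit.
Unset Printing Implicit Defensive.

Import Order.TTheory.

Local Open Scope order_scope.
Local Open Scope classical_set_scope.

Record category := Category {
  obj :> Type;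
  hom : obj -> obj -> Type;
  idm : forall a, hom a a;
  comp : forall a b c, hom b c -> hom a b -> hom a c;
  comp_idl : forall a b (f : hom a b), comp (idm b) f = f;
  comp_idr : forall a b (f : hom a b), comp f (idm a) = f;
  comp_assoc : forall a b c e (h : hom c e) (g : hom b c) (f : hom a b),
    comp h (comp g f) = comp (comp h g) f }.

Arguments hom {_} _ _.
Arguments idm {_} _.
Arguments comp {_ _ _ _} _ _.

Definition opposite (A : category) : category :=
  @Category A (fun a b => hom b a) (@idm A) (fun _ _ _ g f => comp f g)
    (fun _ _ f => comp_idr f) (fun _ _ f => comp_idl f)
    (fun _ _ _ _ h g f => esym (comp_assoc f g h)).

Record functor (A B : category) := Functor {
  fobj :> A -> B;
  fmor : forall a b, hom a b -> hom (fobj a) (fobj b);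
  fmor_id : forall a, fmor (idm a) = idm (fobj a);
  fmor_comp : forall a b c (g : hom b c) (f : hom a b),
    fmor (comp g f) = comp (fmor g) (fmor f) }.

Arguments fmor {_ _} _ {_ _} _.

(* F is left adjoint to G: bijections hom (F a) b -> hom a (G b), natural in b
   and in a. *)
Definition left_adjoint (A B : category) (F : functor A B) (G : functor B A) :
    Prop :=
  exists phi : forall (a : A) (b : B), hom (F a) b -> hom a (G b),
    [/\ forall a b, bijective (phi a b),
        forall a b b' (g : hom b b') (u : hom (F a) b),
          phi a b' (comp g u) = comp (fmor G g) (phi a b u)
      & forall a a' b (f : hom a' a) (u : hom (F a) b),
          phi a' b (comp u (fmor F f)) = comp (phi a b u) f].

HB.mixin Record isOrtholattice d T of Order.TBLattice d T := {
  oc : T -> T;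
  ocK : forall x, oc (oc x) = x;
  le_oc : forall x y : T, x <= y -> oc y <= oc x;
  meet_oc : forall x : T, (x `&` oc x)%O = \bot;
  join_oc : forall x : T, (x `|` oc x)%O = \top }.

#[short(type="ortholatticeType")]
HB.structure Definition Ortholattice d :=
  { T of Order.TBLattice d T & isOrtholattice d T }.

HB.mixin Record isMonadicOrtholattice d T of Ortholattice d T := {
  mex : T -> T;
  mex_homo : forall x y : T, x <= y -> mex x <= mex y;
  le_mex : forall x : T, x <= mex x;
  mexK : forall x, mex (mex x) = mex x;
  mex_oc_closed : forall x, mex x = x -> mex (oc x) = oc x }.

#[short(type="monadicOrtholatticeType")]
HB.structure Definition MonadicOrtholattice d :=
  { T of Ortholattice d T & isMonadicOrtholattice d T }.

Record is_mol_morphism d d' (L : monadicOrtholatticeType d)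
    (M : monadicOrtholatticeType d') (f : L -> M) : Prop := IsMolMorphism {
  mol_meet : {morph f : x y / (x `&` y)%O};
  mol_join : {morph f : x y / (x `|` y)%O};
  mol_bot : f \bot = \bot;
  mol_top : f \top = \top;
  mol_oc : {morph f : x / oc x};
  mol_mex : {morph f : x / mex x} }.

Record mol_hom d d' (L : monadicOrtholatticeType d)
    (M : monadicOrtholatticeType d') := MolHom {
  mol_fun :> L -> M;
  mol_funP : is_mol_morphism mol_fun }.

Lemma mol_hom_eq d d' (L : monadicOrtholatticeType d)
    (M : monadicOrtholatticeType d') (f g : mol_hom L M) : f =1 g -> f = g.
Proof.
case: f g => [f fP] [g gP] /= /funext fg; rewrite fg in fP *.
by congr MolHom; exact: Prop_irrelevance.
Qed.

(* A display is a notational tag of MathComp orders without mathematical content;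
   it is part of the object so that lattices of every display are objects. *)
Record mol_obj := MolObj {
  mol_disp : Order.disp_t;
  mol_sort :> monadicOrtholatticeType mol_disp }.

Section MolCategory.
Context d1 d2 d3 (L : monadicOrtholatticeType d1)
  (M : monadicOrtholatticeType d2) (N : monadicOrtholatticeType d3).

Lemma is_mol_morphism_id : is_mol_morphism (@idfun L).
Proof. by []. Qed.

Lemma is_mol_morphism_comp (g : M -> N) (f : L -> M) :
  is_mol_morphism g -> is_mol_morphism f -> is_mol_morphism (g \o f).
Proof.
move=> [g1 g2 g3 g4 g5 g6] [f1 f2 f3 f4 f5 f6].
split=> [x y|x y|||x|x] /=.
- by rewrite f1 g1.
- by rewrite f2 g2.
- by rewrite f3 g3.
- by rewrite f4 g4.
- by rewrite f5 g5.
- by rewrite f6 g6.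
Qed.

End MolCategory.

Definition mol_id d (L : monadicOrtholatticeType d) : mol_hom L L :=
  MolHom (is_mol_morphism_id L).

Definition mol_comp d1 d2 d3 (L : monadicOrtholatticeType d1)
    (M : monadicOrtholatticeType d2) (N : monadicOrtholatticeType d3)
    (g : mol_hom M N) (f : mol_hom L M) : mol_hom L N :=
  MolHom (is_mol_morphism_comp (mol_funP g) (mol_funP f)).

Definition mOL : category.
Proof.
apply: (@Category mol_obj (fun L M => mol_hom L M) (fun L => mol_id L)
  (fun _ _ _ g f => mol_comp g f)) => *; exact: mol_hom_eq.
Defined.

HB.mixin Record isOrthoframe X := {
  perp : X -> X -> Prop;
  perp_irrefl : forall x, ~ perp x x;
  perp_sym : forall x y, perp x y -> perp y x }.

#[short(type="orthoframeType")]
HB.structure Definition Orthoframe := { X of isOrthoframe X }.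

Definition ortho (X : orthoframeType) (S : set X) : set X :=
  [set y | forall x, S x -> perp x y].

Definition biortho_closed (X : orthoframeType) (S : set X) : Prop :=
  S = ortho (ortho S).

Definition rel_image T (R : T -> T -> Prop) (A : set T) : set T :=
  [set y | exists2 x, A x & R x y].

HB.mixin Record isMonadicOrthoframe X of Orthoframe X := {
  mrel : X -> X -> Prop;
  mrel_refl : forall x, mrel x x;
  mrel_trans : forall x y z, mrel x y -> mrel y z -> mrel x z;
  mrel_ortho : forall x,
    rel_image mrel (ortho (rel_image mrel [set x]))
      `<=` ortho (rel_image mrel [set x]) }.

#[short(type="monadicOrthoframeType")]
HB.structure Definition MonadicOrthoframe :=
  { X of Orthoframe X & isMonadicOrthoframe X }.

#[short(type="topOrthoframeType")]
HB.structure Definition TopologicalOrthoframe :=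
  { X of Topological X & Orthoframe X }.

Definition clopen_biortho (X : topOrthoframeType) : set (set X) :=
  [set U | clopen U /\ biortho_closed U].

HB.mixin Record isOrthospace d X
    of POrderedTopological d X & TopologicalOrthoframe X := {
  os_compact : compact [set: X];
  os_separated : forall x y : X, ~~ (x <= y) ->
    exists U, [/\ @clopen_biortho X U, U x & ~ U y];
  os_perp_le : forall x y z : X, perp x z -> x <= y -> perp y z;
  os_ortho : forall U, @clopen_biortho X U -> @clopen_biortho X (ortho U);
  os_perp : forall x y : X, perp x y ->
    exists U, [/\ @clopen_biortho X U, U x & ortho U y] }.

#[short(type="orthospaceType")]
HB.structure Definition Orthospace d :=
  { X of POrderedTopological d X & TopologicalOrthoframe X
       & isOrthospace d X }.

HB.mixin Record isMonadicOrthospace d X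
    of Orthospace d X & MonadicOrthoframe X := {
  mrel_clopen_biortho : forall U, @clopen_biortho X U ->
    @clopen_biortho X (rel_image mrel U) }.

#[short(type="monadicOrthospaceType")]
HB.structure Definition MonadicOrthospace d :=
  { X of Orthospace d X & MonadicOrthoframe X & isMonadicOrthospace d X }.

(* Preservation of the order is not part of the definition. *)
Record is_os_morphism d d' (P : orthospaceType d) (X : orthospaceType d')
    (phi : P -> X) : Prop := IsOsMorphism {
  os_continuous : continuous phi;
  os_perp_reflect : forall p q, perp (phi p) (phi q) -> perp p q;
  os_lift : forall p x, ~ perp x (phi p) ->
    exists q, ~ perp q p /\ ortho (ortho [set x]) (phi q) }.

Record is_mos_morphism d d' (X : monadicOrthospaceType d)
    (Y : monadicOrthospaceType d') (phi : X -> Y) : Prop := IsMosMorphism {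
  mos_os : is_os_morphism phi;
  mos_mrel : forall U, clopen_biortho U ->
    rel_image mrel (phi @^-1` U) = phi @^-1` (rel_image mrel U) }.

Record mos_hom d d' (X : monadicOrthospaceType d)
    (Y : monadicOrthospaceType d') := MosHom {
  mos_fun :> X -> Y;
  mos_funP : is_mos_morphism mos_fun }.

Lemma mos_hom_eq d d' (X : monadicOrthospaceType d)
    (Y : monadicOrthospaceType d') (f g : mos_hom X Y) : f =1 g -> f = g.
Proof.
case: f g => [f fP] [g gP] /= /funext fg; rewrite fg in fP *.
by congr MosHom; exact: Prop_irrelevance.
Qed.

(* As for mol_obj, with the display of the partial order. *)
Record mos_obj := MosObj {
  mos_disp : Order.disp_t;
  mos_sort :> monadicOrthospaceType mos_disp }.

Section OrthoframeTheory.
Context (X : orthoframeType).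
Implicit Types S A B : set X.

Lemma orthoS A B : A `<=` B -> ortho B `<=` ortho A.
Proof. by move=> AB y By x /AB; exact: By. Qed.

Lemma sub_biortho S : S `<=` ortho (ortho S).
Proof. by move=> x Sx y Sy; apply: perp_sym; exact: Sy. Qed.

Lemma biortho_closed_ortho S : biortho_closed (ortho S).
Proof.
apply/seteqP; split; first exact: sub_biortho.
exact: orthoS (@sub_biortho S).
Qed.

Lemma biortho_sub S A : biortho_closed A -> S `<=` A -> ortho (ortho S) `<=` A.
Proof. by move=> bA SA; rewrite bA; exact/orthoS/orthoS. Qed.

Lemma orthoU A B : ortho (A `|` B) = ortho A `&` ortho B.
Proof.
apply/seteqP; split=> [y yAB|y [yA yB] x [/yA|/yB]//].
by split=> x ?; apply: yAB; [left|right].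
Qed.

Lemma biortho_closedI A B :
  biortho_closed A -> biortho_closed B -> biortho_closed (A `&` B).
Proof.
by move=> bA bB; rewrite bA bB -orthoU; exact: biortho_closed_ortho.
Qed.

Lemma ortho0 : ortho (@set0 X) = setT.
Proof. by apply/seteqP; split=> // y _ x []. Qed.

Lemma ortho_setT : ortho (@setT X) = set0.
Proof.
by apply/seteqP; split=> // y /(_ y I); exact: perp_irrefl.
Qed.

Lemma setI_ortho S : S `&` ortho S = set0.
Proof.
by apply/seteqP; split=> // x [Sx /(_ _ Sx)]; exact: perp_irrefl.
Qed.

End OrthoframeTheory.

Section OrthospaceTheory.
Context d (X : orthospaceType d).
Implicit Types U V : set X.

Lemma clopen_biortho0 : clopen_biortho (@set0 X).
Proof.
by split; [exact: clopen0|rewrite /biortho_closed ortho0 ortho_setT].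
Qed.

Lemma clopen_biorthoT : clopen_biortho (@setT X).
Proof.
by split; [exact: clopenT|rewrite /biortho_closed ortho_setT ortho0].
Qed.

Lemma clopen_biorthoI U V :
  clopen_biortho U -> clopen_biortho V -> clopen_biortho (U `&` V).
Proof.
move=> [cU bU] [cV bV]; split; first exact: clopenI.
exact: biortho_closedI.
Qed.

Lemma clopen_biorthoU U V :
  clopen_biortho U -> clopen_biortho V ->
  clopen_biortho (ortho (ortho (U `|` V))).
Proof.
move=> /os_ortho cU /os_ortho cV; rewrite orthoU; apply: os_ortho.
exact: clopen_biorthoI.
Qed.

End OrthospaceTheory.

Section OrthospaceMorphisms.
Context d d' (P : orthospaceType d) (X : orthospaceType d').

Lemma preimage_ortho (phi : P -> X) S : is_os_morphism phi ->
  biortho_closed S -> phi @^-1` (ortho S) = ortho (phi @^-1` S).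
Proof.
move=> [_ phi1 phi2] bS; apply/seteqP; split=> [q Sq p Sp|q Sq x Sx].
  by apply: phi1; exact: Sq.
apply: contrapT => /phi2[p [pq xp]]; apply: pq; apply: Sq.
by move: xp; apply: biortho_sub => // _ ->.
Qed.

Lemma preimage_biortho_closed (phi : P -> X) S : is_os_morphism phi ->
  biortho_closed S -> biortho_closed (phi @^-1` S).
Proof.
move=> phiP bS; rewrite bS preimage_ortho //; first exact: biortho_closed_ortho.
exact: biortho_closed_ortho.
Qed.

Lemma preimage_clopen_biortho (phi : P -> X) U : is_os_morphism phi ->
  clopen_biortho U -> clopen_biortho (phi @^-1` U).
Proof.
move=> phiP [cU bU]; split; last exact: preimage_biortho_closed.
by apply: preimage_clopen => //; exact: os_continuous phiP.
Qed.

Lemma is_os_morphism_id : is_os_morphism (@idfun P).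
Proof.
split=> [x|//|p x xp]; first exact: cvg_id.
by exists x; split=> //; exact: sub_biortho.
Qed.

End OrthospaceMorphisms.

Lemma is_os_morphism_comp d1 d2 d3 (P : orthospaceType d1)
    (X : orthospaceType d2) (Y : orthospaceType d3)
    (psi : X -> Y) (phi : P -> X) :
  is_os_morphism psi -> is_os_morphism phi -> is_os_morphism (psi \o phi).
Proof.
move=> psiP phiP; split.
- move=> x; apply: continuous_comp.
    exact: (os_continuous phiP).
  exact: (os_continuous psiP).
- by move=> p q /(os_perp_reflect psiP)/(os_perp_reflect phiP).
- move=> p y /(os_lift psiP)[x [xp yx]].
  have [q [qp xq]] := os_lift phiP xp.
  exists q; split=> //=.
  have bY := preimage_biortho_closed psiP (biortho_closed_ortho (ortho [set y])).
  by apply: (biortho_sub bY _ xq) => _ ->.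
Qed.

Section MosCategory.
Context d1 d2 d3 (X : monadicOrthospaceType d1)
  (Y : monadicOrthospaceType d2) (Z : monadicOrthospaceType d3).

Lemma is_mos_morphism_id : is_mos_morphism (@idfun X).
Proof. by split=> //; exact: is_os_morphism_id. Qed.

Lemma is_mos_morphism_comp (psi : Y -> Z) (phi : X -> Y) :
  is_mos_morphism psi -> is_mos_morphism phi -> is_mos_morphism (psi \o phi).
Proof.
move=> [psiP psiR] [phiP phiR]; split; first exact: is_os_morphism_comp.
move=> U cU; rewrite comp_preimage phiR; last exact: preimage_clopen_biortho.
by rewrite psiR.
Qed.

End MosCategory.

Definition mos_id d (X : monadicOrthospaceType d) : mos_hom X X :=
  MosHom (is_mos_morphism_id X).

Definition mos_comp d1 d2 d3 (X : monadicOrthospaceType d1)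
    (Y : monadicOrthospaceType d2) (Z : monadicOrthospaceType d3)
    (psi : mos_hom Y Z) (phi : mos_hom X Y) : mos_hom X Z :=
  MosHom (is_mos_morphism_comp (mos_funP psi) (mos_funP phi)).

Definition mOS : category.
Proof.
apply: (@Category mos_obj (fun X Y => mos_hom X Y) (fun X => mos_id X)
  (fun _ _ _ g f => mos_comp g f)) => *; exact: mos_hom_eq.
Defined.

Record pfilter d (L : latticeType d) := PFilter {
  pf_set :> L -> Prop;
  pf_neq0 : pf_set !=set0;
  pf_up : forall a b, a <= b -> pf_set a -> pf_set b;
  pf_meet : forall a b, pf_set a -> pf_set b -> pf_set (a `&` b)%O;
  pf_proper : pf_set <> setT }.

Lemma pfilter_eq d (L : latticeType d) (x y : pfilter L) :
  pf_set x = pf_set y -> x = y.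
Proof.
case: x y => [x x1 x2 x3 x4] [y y1 y2 y3 y4] /= xy.
move: x1 x2 x3 x4; rewrite xy => x1 x2 x3 x4.
by congr PFilter; exact: Prop_irrelevance.
Qed.

HB.instance Definition _ d (L : latticeType d) := gen_eqMixin (pfilter L).
HB.instance Definition _ d (L : latticeType d) := gen_choiceMixin (pfilter L).

Section PFilterOrder.
Context d (L : latticeType d).

Definition pf_le (x y : pfilter L) : bool := `[< pf_set x `<=` pf_set y >].

Lemma pf_leP (x y : pfilter L) : reflect (pf_set x `<=` pf_set y) (pf_le x y).
Proof. exact: asboolP. Qed.

Lemma pf_le_refl : reflexive pf_le.
Proof. by move=> x; apply/pf_leP. Qed.

Lemma pf_le_anti : antisymmetric pf_le.
Proof.
move=> x y /andP[/pf_leP xy /pf_leP yx].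
by apply: pfilter_eq; exact/seteqP.
Qed.

Lemma pf_le_trans : transitive pf_le.
Proof.
move=> y x z /pf_leP xy /pf_leP yz; apply/pf_leP.
exact: subset_trans xy yz.
Qed.

HB.instance Definition _ := Order.Le_isPOrder.Build d (pfilter L)
  pf_le_refl pf_le_anti pf_le_trans.

Definition pf_basic (a : L) : set (pfilter L) := [set x : pfilter L | x a].

Definition pf_subbase : set (set (pfilter L)) :=
  [set U | exists a, U = pf_basic a \/ U = ~` pf_basic a].

HB.instance Definition _ := isSubBaseTopological.Build (pfilter L)
  pf_subbase id.

Lemma open_pf_subbase U : pf_subbase U -> open U.
Proof.
move=> bU; exists [set U]; last by rewrite bigcup_set1.
move=> _ ->; exists [fset U]%fset.
  by move=> V /fset1P ->; exact: mem_set.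
by rewrite set_fset1 bigcap_set1.
Qed.

Lemma pf_subbase_cvg (F : set_system (pfilter L)) (x : pfilter L) :
  Filter F -> (forall U, pf_subbase U -> U x -> F U) -> F --> x.
Proof.
move=> FF Fx A /=; rewrite nbhsE => -[_ [[B sB <-] [C BC Cx] sUBA]].
rewrite nbhs_filterE; apply: filterS sUBA _; apply: (@filterS _ _ _ C).
  by move=> y Cy; exists C.
have /sB [D sD IDeC] := BC; rewrite -IDeC; apply: filter_bigI => E DE.
apply: Fx; first by have /sD := DE; rewrite inE.
by move: Cx; rewrite -IDeC => /(_ _ DE).
Qed.

Lemma clopen_pf_basic a : clopen (pf_basic a).
Proof.
split; first by apply: open_pf_subbase; exists a; left.
rewrite -[pf_basic a]setCK; apply: open_closedC.
by apply: open_pf_subbase; exists a; right.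
Qed.

End PFilterOrder.

Section PFilterBounded.
Context d (L : tbLatticeType d).
Implicit Types x y : pfilter L.

Lemma pf_top x : x \top.
Proof. by have [a xa] := pf_neq0 x; apply: pf_up xa; exact: lex1. Qed.

Lemma pf_bot x : ~ x \bot.
Proof.
move=> x0; apply: (@pf_proper _ _ x); apply/seteqP; split=> // a _.
by apply: pf_up x0; exact: le0x.
Qed.

Lemma set_proper (A : set L) : ~ A \bot -> A <> setT.
Proof. by move=> A0 AT; apply: A0; rewrite AT. Qed.

Section Generated.
Variables (B : set L) (B_neq0 : B !=set0).
Hypothesis B_meet : forall a b, B a -> B b -> exists2 c, B c & c <= (a `&` b)%O.
Hypothesis B_bot : ~ B \bot.

Let pf_gen_set : set L := [set b | exists2 a, B a & a <= b].

Let pf_gen_neq0 : pf_gen_set !=set0.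
Proof. by have [a Ba] := B_neq0; exists a, a. Qed.

Let pf_gen_up a b : a <= b -> pf_gen_set a -> pf_gen_set b.
Proof. by move=> ab [c Bc ca]; exists c => //; exact: le_trans ab. Qed.

Let pf_gen_meet a b : pf_gen_set a -> pf_gen_set b -> pf_gen_set (a `&` b)%O.
Proof.
move=> [c Bc ca] [e Be eb]; have [g Bg gce] := B_meet Bc Be; exists g => //.
by apply: le_trans gce _; rewrite leI2.
Qed.

Let pf_gen_proper : pf_gen_set <> setT.
Proof.
by apply: set_proper => -[a Ba]; rewrite lex0 => /eqP a0; rewrite a0 in Ba.
Qed.

Definition pf_gen : pfilter L :=
  PFilter pf_gen_neq0 pf_gen_up pf_gen_meet pf_gen_proper.

End Generated.

Lemma pf_principal_exists (a : L) : a != \bot ->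
  exists x : pfilter L, forall b, x b <-> a <= b.
Proof.
move=> a0.
have B1 : [set a] !=set0 by exists a.
have B2 b c : [set a] b -> [set a] c -> exists2 e, [set a] e & e <= (b `&` c)%O.
  by move=> -> ->; exists a => //; rewrite meetxx.
have B3 : ~ [set a] \bot by move=> /= a0'; rewrite -a0' eqxx in a0.
exists (pf_gen B1 B2 B3) => b; split=> [[c ->]//|ab].
by exists a.
Qed.

Lemma pfilter_compact : compact [set: pfilter L].
Proof.
rewrite compact_ultra => F FU _.
have FF : ProperFilter F := ultra_proper.
pose p : set L := [set a | F (@pf_basic _ L a)].
have p1 : p !=set0.
  exists \top; apply: filterS filterT => x _; exact: pf_top.
have p2 a b : a <= b -> p a -> p b.
  by move=> ab; apply: filterS => x; exact: pf_up ab.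
have p3 a b : p a -> p b -> p (a `&` b)%O.
  move=> pa pb; apply: filterS (filterI pa pb) => x [xa xb].
  exact: pf_meet.
have p4 : p <> setT.
  apply: set_proper => p0; apply: (@filter_not_empty _ F).
  by apply: filterS p0 => x /pf_bot.
exists (PFilter p1 p2 p3 p4); split=> //.
apply: pf_subbase_cvg => U [a [->//|->]] pa.
by have [] := in_ultra_setVsetC (@pf_basic _ L a) FU.
Qed.

End PFilterBounded.

Section OrtholatticeTheory.
Context d (L : ortholatticeType d).

Lemma oc0 : oc (\bot : L) = \top.
Proof. by rewrite -[LHS]join0x join_oc. Qed.

Lemma oc1 : oc (\top : L) = \bot.
Proof. by rewrite -[LHS]meet1x meet_oc. Qed.

Lemma oc_join (a b : L) : oc (a `|` b)%O = (oc a `&` oc b)%O.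
Proof.
apply/le_anti/andP; split; first by rewrite lexI !le_oc ?leUl ?leUr.
rewrite -[X in X <= _]ocK le_oc // leUx -{1}[a]ocK -{2}[b]ocK.
by rewrite !le_oc ?leIl ?leIr.
Qed.

End OrtholatticeTheory.

Section PFilterOrthoframe.
Context d (L : ortholatticeType d).
Implicit Types x y z : pfilter L.

Definition pf_perp x y : Prop := exists a, [/\ a != \bot, x a & y (oc a)].

Lemma pf_perp_irrefl x : ~ pf_perp x x.
Proof.
move=> [a [_ xa xa']]; apply: (@pf_bot _ _ x).
by rewrite -(meet_oc a); exact: pf_meet.
Qed.

Lemma pf_perp_sym x y : pf_perp x y -> pf_perp y x.
Proof.
move=> [a [a0 xa ya]]; exists (oc a); rewrite ocK; split=> //.
by apply/eqP => a0'; rewrite a0' in ya; exact: pf_bot ya.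
Qed.

HB.instance Definition _ :=
  isOrthoframe.Build (pfilter L) pf_perp_irrefl pf_perp_sym.

Lemma pf_perpP x y : perp x y <-> exists2 a, x a & y (oc a).
Proof.
split=> [[a [_ xa ya]]|[a xa ya]]; first by exists a.
exists a; split=> //; apply/eqP => a0; rewrite a0 in xa; exact: pf_bot xa.
Qed.

Lemma ortho_pf_basic (a : L) :
  ortho (@pf_basic _ L a) = @pf_basic _ L (oc a).
Proof.
apply/seteqP; split=> y ya; last by move=> x xa; apply/pf_perpP; exists a.
have [a0|a0] := eqVneq a \bot; first by rewrite /pf_basic /= a0 oc0; exact: pf_top.
have [x xP] := pf_principal_exists a0.
have /pf_perpP[b /xP ab yb] : perp x y by apply: ya; apply/xP.
by apply: pf_up yb; exact: le_oc.
Qed.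

Lemma clopen_biortho_pf_basic (a : L) : clopen_biortho (@pf_basic _ L a).
Proof.
split; first exact: clopen_pf_basic.
by rewrite /biortho_closed !ortho_pf_basic ocK.
Qed.

Lemma biortho_pf x : ortho (ortho [set x]) = [set y | pf_set x `<=` pf_set y].
Proof.
apply/seteqP; split=> y.
- move=> xy a xa.
  suff : @pf_basic _ L a y by [].
  have [_ ba] := clopen_biortho_pf_basic a.
  by apply: biortho_sub ba _ _ xy => _ ->.
- move=> /= xy z /(_ x erefl) /pf_perpP[a xa za].
  by apply: perp_sym; apply/pf_perpP; exists a => //; exact: xy.
Qed.

End PFilterOrthoframe.

Lemma compact_directed (X : topologicalType) I (D : set I) (f : I -> set X) :
  compact [set: X] -> D !=set0 ->
  (forall i, D i -> closed (f i) /\ f i !=set0) ->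
  (forall i j, D i -> D j -> exists2 k, D k & f k `<=` f i `&` f j) ->
  exists x, forall i, D i -> f i x.
Proof.
move=> cX D0 fD fI; pose F := filter_from D f.
have FF : Filter F by exact: filter_from_filter.
have PF : ProperFilter F by apply: filter_from_proper => i /fD[].
have [x [_ Fx]] := cX F PF filterT.
exists x => i Di; have [fc _] := fD i Di; apply: fc => B Bx.
by apply: Fx => //; exists i.
Qed.

Section PFilterOrthospace.
Context d (L : ortholatticeType d).
Implicit Types (x y z : pfilter L) (U : set (pfilter L)).

Local Notation h := (@pf_basic _ L).

Lemma clopen_biortho_pf_separate U y : clopen_biortho U -> ortho U y ->
  exists2 a, U `<=` h a & y (oc a).
Proof.
move=> [[_ cU] _] Uy; apply: contrapT => nU.
have [||a ya|a b ya yb|x xP] := @compact_directed (pfilter L) L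
    [set a | y (oc a)] (fun a => U `&` ~` h a).
- exact: pfilter_compact.
- by exists \bot; rewrite /= oc0; exact: pf_top.
- split.
    apply: closedI => //; apply: open_closedC.
    by have [] := clopen_pf_basic a.
  apply: contrapT => e; apply: nU; exists a => // x Ux.
  by apply: contrapT => xa; apply: e; exists x.
- exists (a `|` b)%O; first by rewrite /= oc_join; exact: pf_meet.
  move=> x [Ux xab]; split; split=> //.
    by move=> xa; apply: xab; apply: pf_up xa; exact: leUl.
  by move=> xa; apply: xab; apply: pf_up xa; exact: leUr.
- have [Ux _] : (U `&` ~` h \bot) x by apply: xP; rewrite /= oc0; exact: pf_top.
  have /pf_perpP[a xa ya] := Uy x Ux.
  by have [_] := xP a ya.
Qed.

Lemma clopen_biorthoE : @clopen_biortho (pfilter L) = range h.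
Proof.
apply/seteqP; split=> [U cU|_ [a _ <-]]; last exact: clopen_biortho_pf_basic.
apply: contrapT => nU; case: (cU) => -[oU _] bU.
have [||a Ua|a b Ua Ub|x xP] := @compact_directed (pfilter L) L
    [set a | U `<=` h a] (fun a => h a `&` ~` U).
- exact: pfilter_compact.
- by exists \top => x _; exact: pf_top.
- split.
    apply: closedI; first by have [] := clopen_pf_basic a.
    exact: open_closedC.
  apply: contrapT => e; apply: nU; exists a => //.
  apply/seteqP; split=> // x xa.
  by apply: contrapT => Ux; apply: e; exists x.
- exists (a `&` b)%O.
    by move=> x Ux; apply: pf_meet; [exact: Ua|exact: Ub].
  move=> x [xab Ux]; split; split=> //.
    by apply: pf_up xab; exact: leIl.
  by apply: pf_up xab; exact: leIr.
- have [_ nUx] : (h \top `&` ~` U) x by apply: xP => y _; exact: pf_top.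
  apply: nUx; rewrite bU => y Uy.
  have [a Ua ya] := clopen_biortho_pf_separate cU Uy.
  have [xa _] := xP a Ua.
  by apply: perp_sym; apply/pf_perpP; exists a.
Qed.

Lemma pf_os_separated x y : ~~ (x <= y) ->
  exists U, [/\ clopen_biortho U, U x & ~ U y].
Proof.
move=> nxy; apply: contrapT => nU; move/negP: nxy; apply.
apply/pf_leP => a xa; apply: contrapT => ya; apply: nU.
by exists (h a); split=> //; exact: clopen_biortho_pf_basic.
Qed.

Lemma pf_os_perp_le x y z : perp x z -> x <= y -> perp y z.
Proof.
move=> /pf_perpP[a xa za] /pf_leP xy; apply/pf_perpP.
by exists a => //; exact: xy.
Qed.

Lemma pf_os_ortho U : clopen_biortho U -> clopen_biortho (ortho U).
Proof.
rewrite clopen_biorthoE => -[a _ <-].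
by exists (oc a) => //; rewrite ortho_pf_basic.
Qed.

Lemma pf_os_perp x y : perp x y ->
  exists U, [/\ clopen_biortho U, U x & ortho U y].
Proof.
move=> /pf_perpP[a xa ya]; exists (h a); split=> //.
  exact: clopen_biortho_pf_basic.
by rewrite ortho_pf_basic.
Qed.

HB.instance Definition _ := isOrthospace.Build d (pfilter L)
  (@pfilter_compact _ L) pf_os_separated pf_os_perp_le pf_os_ortho pf_os_perp.

End PFilterOrthospace.

Section MonadicOrtholatticeTheory.
Context d (L : monadicOrtholatticeType d).

Lemma mex1 : mex (\top : L) = \top.
Proof. by apply/le_anti; rewrite lex1 le_mex. Qed.

Lemma mex0 : mex (\bot : L) = \bot.
Proof. by rewrite -oc1; apply: mex_oc_closed; exact: mex1. Qed.

Lemma mex_oc_mex (a : L) : mex (oc (mex a)) = oc (mex a).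
Proof. by apply: mex_oc_closed; exact: mexK. Qed.

End MonadicOrtholatticeTheory.

Section PFilterMonadic.
Context d (L : monadicOrtholatticeType d).
Implicit Types (x y z : pfilter L).

Local Notation h := (@pf_basic _ L).

Definition pf_rel x y : Prop := (@mex _ L) @` pf_set x `<=` pf_set y.

Lemma pf_relP x y : pf_rel x y <-> forall a, x a -> y (mex a).
Proof.
split=> [xy a xa|xy _ [a xa <-]]; last exact: xy.
by apply: xy; exists a.
Qed.

Lemma pf_rel_refl x : pf_rel x x.
Proof. by apply/pf_relP => a; apply: pf_up; exact: le_mex. Qed.

Lemma pf_rel_trans x y z : pf_rel x y -> pf_rel y z -> pf_rel x z.
Proof.
move=> /pf_relP xy /pf_relP yz; apply/pf_relP => a /xy/yz.
by rewrite mexK.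
Qed.

Lemma pf_rel_least x : exists2 w, pf_rel x w &
  forall b, w b -> exists2 a, x a & mex a <= b.
Proof.
have B1 : (@mex _ L) @` pf_set x !=set0.
  by exists (mex \top), \top => //; exact: pf_top.
have B2 b c : ((@mex _ L) @` pf_set x) b -> ((@mex _ L) @` pf_set x) c ->
    exists2 e, ((@mex _ L) @` pf_set x) e & e <= (b `&` c)%O.
  move=> [a xa <-] [a' xa' <-]; exists (mex (a `&` a')%O).
    by exists (a `&` a')%O => //; exact: pf_meet.
  by rewrite lexI !mex_homo ?leIl ?leIr.
have B3 : ~ ((@mex _ L) @` pf_set x) \bot.
  move=> [a xa a0]; apply: (@pf_bot _ _ x); apply: pf_up xa.
  by rewrite -a0; exact: le_mex.
exists (pf_gen B1 B2 B3).
  by move=> b xb; exists b.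
by move=> b [_ [a xa <-] ab]; exists a.
Qed.

Lemma pf_rel_ortho x : rel_image pf_rel (ortho (rel_image pf_rel [set x]))
  `<=` ortho (rel_image pf_rel [set x]).
Proof.
move=> z [y xy /pf_relP yz] w [_ -> /pf_relP xw].
have [v xv vP] := pf_rel_least x.
have /pf_perpP[b vb yb] : perp v y by apply: xy; exists x.
have [a xa ab] := vP b vb.
apply/pf_perpP; exists (mex a); first exact: xw.
rewrite -mex_oc_mex; apply: yz; apply: pf_up yb; exact: le_oc.
Qed.

HB.instance Definition _ := isMonadicOrthoframe.Build (pfilter L)
  pf_rel_refl pf_rel_trans pf_rel_ortho.

Lemma rel_image_pf_basic (a : L) : rel_image mrel (h a) = h (mex a).
Proof.
apply/seteqP; split=> [y [x xa /pf_relP xy]|y ya]; first exact: xy.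
have a0 : a != \bot.
  by apply/eqP => a0; move: ya; rewrite a0 /h /= mex0; exact: pf_bot.
have [x xP] := pf_principal_exists a0.
exists x; first by apply/xP.
apply/pf_relP => b /xP ab; apply: pf_up ya; exact: mex_homo.
Qed.

Lemma pf_rel_clopen_biortho U : @clopen_biortho (pfilter L) U ->
  @clopen_biortho (pfilter L) (rel_image mrel U).
Proof.
rewrite clopen_biorthoE => -[a _ <-].
by exists (mex a) => //; rewrite rel_image_pf_basic.
Qed.

HB.instance Definition _ := isMonadicOrthospace.Build d (pfilter L)
  pf_rel_clopen_biortho.

End PFilterMonadic.

Record cbset d (X : orthospaceType d) := CBSet {
  cb_set :> set X;
  cbP : clopen_biortho cb_set }.

Lemma cbset_eq d (X : orthospaceType d) (U V : cbset X) :
  (U : set X) = V -> U = V.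
Proof.
case: U V => [U UP] [V VP] /= UV; rewrite UV in UP *.
by congr CBSet; exact: Prop_irrelevance.
Qed.

HB.instance Definition _ d (X : orthospaceType d) := gen_eqMixin (cbset X).
HB.instance Definition _ d (X : orthospaceType d) := gen_choiceMixin (cbset X).

Section CBSetOrtholattice.
Context d (X : orthospaceType d).
Implicit Types U V W : cbset X.

Definition cb_le U V : bool := `[< (U : set X) `<=` V >].

Lemma cb_leP U V : reflect ((U : set X) `<=` V) (cb_le U V).
Proof. exact: asboolP. Qed.

Lemma cb_le_refl : reflexive cb_le.
Proof. by move=> U; apply/cb_leP. Qed.

Lemma cb_le_anti : antisymmetric cb_le.
Proof.
move=> U V /andP[/cb_leP UV /cb_leP VU].
by apply: cbset_eq; exact/seteqP.
Qed.

Lemma cb_le_trans : transitive cb_le.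
Proof.
move=> V U W /cb_leP UV /cb_leP VW; apply/cb_leP.
exact: subset_trans UV VW.
Qed.

HB.instance Definition _ := Order.Le_isPOrder.Build d (cbset X)
  cb_le_refl cb_le_anti cb_le_trans.

Definition cb_bot : cbset X := CBSet (clopen_biortho0 X).
Definition cb_top : cbset X := CBSet (clopen_biorthoT X).
Definition cb_meet U V : cbset X := CBSet (clopen_biorthoI (cbP U) (cbP V)).
Definition cb_join U V : cbset X := CBSet (clopen_biorthoU (cbP U) (cbP V)).
Definition cb_oc U : cbset X := CBSet (os_ortho _ (cbP U)).

Lemma cb_meetP U V W : (U <= cb_meet V W) = (U <= V) && (U <= W).
Proof.
apply/cb_leP/andP => [UVW|[/cb_leP UV /cb_leP UW] x Ux].
  by split; apply/cb_leP => x /UVW[].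
by split; [exact: UV|exact: UW].
Qed.

Lemma cb_joinP U V W : (cb_join U V <= W) = (U <= W) && (V <= W).
Proof.
apply/cb_leP/andP => [UVW|[/cb_leP UW /cb_leP VW]].
  by split; apply/cb_leP => x ?; apply: UVW; apply: sub_biortho;
    [left|right].
by apply: biortho_sub; [case: (cbP W)|rewrite subUset].
Qed.

HB.instance Definition _ := Order.POrder_MeetJoin_isLattice.Build d (cbset X)
  cb_meetP cb_joinP.

Lemma cb_le0 U : cb_bot <= U.
Proof. by apply/cb_leP. Qed.

Lemma cb_le1 U : U <= cb_top.
Proof. by apply/cb_leP. Qed.

HB.instance Definition _ := Order.hasBottom.Build d (cbset X) cb_le0.
HB.instance Definition _ := Order.hasTop.Build d (cbset X) cb_le1.

Lemma cb_ocK U : cb_oc (cb_oc U) = U.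
Proof. by apply: cbset_eq; case: (cbP U). Qed.

Lemma cb_le_oc U V : U <= V -> cb_oc V <= cb_oc U.
Proof. by move=> /cb_leP UV; apply/cb_leP; exact: orthoS. Qed.

Lemma cb_meet_oc U : (U `&` cb_oc U)%O = \bot.
Proof. by apply: cbset_eq; exact: setI_ortho. Qed.

Lemma cb_join_oc U : (U `|` cb_oc U)%O = \top.
Proof.
by apply: cbset_eq; rewrite /= orthoU setI_ortho ortho0.
Qed.

HB.instance Definition _ := isOrtholattice.Build d (cbset X)
  cb_ocK cb_le_oc cb_meet_oc cb_join_oc.

End CBSetOrtholattice.

Section CBSetMonadic.
Context d (X : monadicOrthospaceType d).
Implicit Types U V : cbset X.

Definition cb_mex U : cbset X :=
  CBSet (os_ortho _ (os_ortho _ (mrel_clopen_biortho _ (cbP U)))).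

Lemma cb_mexE U : cb_mex U = rel_image mrel U :> set X.
Proof. by have [_ /esym] := mrel_clopen_biortho _ (cbP U). Qed.

Lemma cb_mex_homo U V : U <= V -> cb_mex U <= cb_mex V.
Proof.
move=> /cb_leP UV; apply/cb_leP; rewrite !cb_mexE => y [x Ux xy].
by exists x => //; exact: UV.
Qed.

Lemma cb_le_mex U : U <= cb_mex U.
Proof.
by apply/cb_leP; rewrite cb_mexE => x Ux; exists x => //; exact: mrel_refl.
Qed.

Lemma cb_mexK U : cb_mex (cb_mex U) = cb_mex U.
Proof.
apply/le_anti; rewrite cb_le_mex andbT; apply/cb_leP.
rewrite !cb_mexE => z [y [x Ux xy] yz]; exists x => //.
exact: mrel_trans yz.
Qed.

Lemma cb_mex_oc_closed U : cb_mex U = U -> cb_mex (oc U) = oc U.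
Proof.
move=> UU; apply/le_anti; rewrite cb_le_mex andbT; apply/cb_leP.
have {}UU : rel_image mrel U = U by rewrite -cb_mexE UU.
rewrite cb_mexE => z [y Uy yz] x Ux.
apply: (@mrel_ortho X x); last by exists x => //; exact: mrel_refl.
exists y => // w [_ -> xw]; apply: Uy; rewrite -UU.
by exists x.
Qed.

HB.instance Definition _ := isMonadicOrtholattice.Build d (cbset X)
  cb_mex_homo cb_le_mex cb_mexK cb_mex_oc_closed.

End CBSetMonadic.

Section PFilterMap.
Context d d' (L : monadicOrtholatticeType d) (M : monadicOrtholatticeType d').
Variable f : mol_hom L M.
Implicit Types x y : pfilter M.

Let fP := mol_funP f.

Let f_homo a b : a <= b -> f a <= f b.
Proof. by rewrite !leEmeet -(mol_meet fP) => /eqP ->. Qed.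

Let pf_map_neq0 x : f @^-1` pf_set x !=set0.
Proof. by exists \top; rewrite /= (mol_top fP); exact: pf_top. Qed.

Let pf_map_up x a b : a <= b -> (f @^-1` pf_set x) a -> (f @^-1` pf_set x) b.
Proof. by move=> ab; apply: pf_up; exact: f_homo. Qed.

Let pf_map_meet x a b :
  (f @^-1` pf_set x) a -> (f @^-1` pf_set x) b -> (f @^-1` pf_set x) (a `&` b)%O.
Proof. by move=> xa xb; rewrite /= (mol_meet fP); exact: pf_meet. Qed.

Let pf_map_proper x : f @^-1` pf_set x <> setT.
Proof. by apply: set_proper; rewrite /= (mol_bot fP); exact: pf_bot. Qed.

Definition pf_map x : pfilter L := PFilter (@pf_map_neq0 x) (@pf_map_up x)
  (@pf_map_meet x) (@pf_map_proper x).

Lemma preimage_pf_basic a :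
  pf_map @^-1` (@pf_basic _ L a) = @pf_basic _ M (f a).
Proof. by []. Qed.

Lemma pf_map_continuous : continuous pf_map.
Proof.
move=> x; apply: pf_subbase_cvg; first by apply: fmap_filter; exact: nbhs_filter.
move=> U [a [->|->]] xa.
  by apply: open_nbhs_nbhs; split=> //; have [] := clopen_pf_basic (f a).
apply: open_nbhs_nbhs; split=> //; apply: closed_openC.
by have [] := clopen_pf_basic (f a).
Qed.

Lemma pf_map_os : is_os_morphism pf_map.
Proof.
split; first exact: pf_map_continuous.
- move=> x y /pf_perpP[a xa ya]; apply/pf_perpP; exists (f a) => //.
  by rewrite -(mol_oc fP).
- move=> p x xp.
  have B1 : f @` pf_set x !=set0 by exists (f \top), \top => //; exact: pf_top.
  have B2 b c : (f @` pf_set x) b -> (f @` pf_set x) c ->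
      exists2 e, (f @` pf_set x) e & e <= (b `&` c)%O.
    move=> [a xa <-] [a' xa' <-]; exists (f (a `&` a')%O).
      by exists (a `&` a')%O => //; exact: pf_meet.
    by rewrite (mol_meet fP).
  have B3 : ~ (f @` pf_set x) \bot.
    move=> [a xa a0]; apply: xp; apply/pf_perpP; exists a => //=.
    by rewrite (mol_oc fP) a0 oc0; exact: pf_top.
  exists (pf_gen B1 B2 B3); split; last first.
    by rewrite biortho_pf => a xa; exists (f a) => //; exists a.
  move=> /pf_perpP[b [_ [a xa <-] ab] pb]; apply: xp.
  apply/pf_perpP; exists a => //=; rewrite (mol_oc fP).
  by apply: pf_up pb; exact: le_oc.
Qed.

Lemma pf_map_mos : is_mos_morphism pf_map.
Proof.
split; first exact: pf_map_os.
move=> U; rewrite clopen_biorthoE => -[a _ <-].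
by rewrite preimage_pf_basic !rel_image_pf_basic -(mol_mex fP).
Qed.

Definition pf_mos_hom : mos_hom (pfilter M) (pfilter L) := MosHom pf_map_mos.

End PFilterMap.

Section CBSetMap.
Context d d' (X : monadicOrthospaceType d) (Y : monadicOrthospaceType d').
Variable phi : mos_hom X Y.

Let phi_os : is_os_morphism phi := mos_os (mos_funP phi).

Definition cb_map (U : cbset Y) : cbset X :=
  CBSet (preimage_clopen_biortho phi_os (cbP U)).

Lemma cb_map_mol : is_mol_morphism cb_map.
Proof.
have bC (U : cbset Y) : biortho_closed U by case: (cbP U).
have oC (U : cbset Y) : cb_map (oc U) = oc (cb_map U).
  by apply: cbset_eq; exact: preimage_ortho.
split=> //.
- by move=> U V; apply: cbset_eq.
- move=> U V; apply: cbset_eq => /=.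
  rewrite preimage_ortho //; last exact: biortho_closed_ortho.
  by rewrite !orthoU preimage_setI !preimage_ortho.
- exact: cbset_eq.
- exact: cbset_eq.
- move=> U; apply: cbset_eq; rewrite [RHS](cb_mexE (cb_map U)) /=.
  rewrite (mos_mrel (mos_funP phi)); last exact: cbP.
  by rewrite -[in RHS]cb_mexE.
Qed.

Definition cb_mol_hom : mol_hom (cbset Y) (cbset X) := MolHom cb_map_mol.

End CBSetMap.

Definition filter_obj (L : mol_obj) : mos_obj := MosObj (pfilter L).

Definition clopen_obj (X : mos_obj) : mol_obj := MolObj (cbset X).

(* A morphism from X to Y in opposite mOS is a mos_hom Y X. *)
Definition filter_functor : functor mOL (opposite mOS).
Proof.
apply: (@Functor mOL (opposite mOS) filter_obj (fun _ _ f => pf_mos_hom f)).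
- by move=> L; apply: mos_hom_eq => x; exact: pfilter_eq.
- by move=> L M N g f; apply: mos_hom_eq => x; exact: pfilter_eq.
Defined.

Definition clopen_functor : functor (opposite mOS) mOL.
Proof.
apply: (@Functor (opposite mOS) mOL clopen_obj (fun _ _ f => cb_mol_hom f)).
- by move=> X; apply: mol_hom_eq => U; exact: cbset_eq.
- by move=> X Y Z g f; apply: mol_hom_eq => U; exact: cbset_eq.
Defined.

(* Main.v *)
From mathcomp Require Import all_boot all_order.
From mathcomp Require Import boolp classical_sets filter topology.
Require Import Defs.

(** The adjunction is a dual one induced by membership: a homomorphism
    f : L -> C(X) and a morphism u : X -> F(L) determine each other through
    the relation between points x and elements a

      x \in f a  <->  a \in u x.

    Equivalently, both transposes are obtained from a unit and a counit: the map
    [eta] sending a to the set of proper filters containing a, and the map [eps]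
    sending x to the filter of clopen bi-orthogonally closed sets containing x.
    Transposing u yields C(u) \o eta and transposing f yields F(f) \o eps; that
    these operations are mutually inverse and natural is then immediate from
    extensionality of sets and filters, so all the content lies in [eta] and
    [eps] being morphisms.

    For [eta] this is the fact that a |-> {x | a \in x} turns meets,
    orthocomplements and the quantifier of L into intersections, orthogonals and
    R-images; joins follow by De Morgan.  For [eps] the only substantial point
    is the lifting condition of orthospace morphisms
    ([pf_point_lift]), which is a compactness argument: if a filter F of
    C(X) is not orthogonal to the filter of p, then F has a common point q that is
    not orthogonal to p. *)

Set Implicit Arguments.
Unset Strict Implicit.
Unset Printing Implicit Defensive.

Import Order.TTheory.

Local Open Scope order_scope.
Local Open Scope classical_set_scope.

Lemma pf_basic_meet d (L : latticeType d) (a b : L) :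
  pf_basic (a `&` b)%O = pf_basic a `&` pf_basic b.
Proof.
apply/seteqP; split=> x; last by move=> [xa xb]; exact: pf_meet.
by move=> xab; split; apply: pf_up xab; [exact: leIl|exact: leIr].
Qed.

Section Unit.
Context d (L : monadicOrtholatticeType d).

Definition cb_basic (a : L) : cbset (pfilter L) :=
  CBSet (clopen_biortho_pf_basic a).

Lemma cb_basic_mol : is_mol_morphism cb_basic.
Proof.
split=> [a b|a b|||a|a]; apply: cbset_eq.
- exact: pf_basic_meet.
- (* The join in C(F(L)) is the double orthogonal of the union, so De Morgan
     reduces the claim to meets. *)
  rewrite /= orthoU !ortho_pf_basic -pf_basic_meet -oc_join.
  by rewrite ortho_pf_basic ocK.
- by apply/seteqP; split=> // x /pf_bot.
- by apply/seteqP; split=> // x _; exact: pf_top.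
- by rewrite /= ortho_pf_basic.
- by rewrite [RHS](cb_mexE (cb_basic a)) /= rel_image_pf_basic.
Qed.

Definition eta : mol_hom L (cbset (pfilter L)) := MolHom cb_basic_mol.

End Unit.

Section Points.
Context d (X : orthospaceType d).
Implicit Types (x p : X) (U V : cbset X).

Let pt_set x : set (cbset X) := [set U | cb_set U x].

Let pt_neq0 x : pt_set x !=set0.
Proof. by exists \top. Qed.

Let pt_up x U V : U <= V -> pt_set x U -> pt_set x V.
Proof. by move=> /cb_leP UV; exact: UV. Qed.

Let pt_meet x U V : pt_set x U -> pt_set x V -> pt_set x (U `&` V)%O.
Proof. by []. Qed.

Let pt_proper x : pt_set x <> setT.
Proof. exact: set_proper. Qed.

Definition pf_point x : pfilter (cbset X) :=
  PFilter (@pt_neq0 x) (@pt_up x) (@pt_meet x) (@pt_proper x).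

Lemma preimage_pf_point U : pf_point @^-1` pf_basic U = U.
Proof. by []. Qed.

Lemma pf_point_continuous : continuous pf_point.
Proof.
move=> x; apply: pf_subbase_cvg.
move=> _ [U [->|->]] xU; apply: open_nbhs_nbhs; split=> //.
  by have [[]] := cbP U.
by apply: closed_openC; have [[]] := cbP U.
Qed.

(** Orthogonality of points is witnessed by members of C(X), so a common point of
    [F] not orthogonal to [p] is a common point of the closed sets U `\` V, with U
    in [F] and [p] orthogonal to V.  Each is nonempty, since U `<=` V would make
    [F] orthogonal to [pf_point p], and they form a directed family because
    (U `&` U') `\` (V `|` V') lies in both U `\` V and U' `\` V', the join being
    larger than the union; compactness then yields the point. *)
Lemma pf_point_lift p (F : pfilter (cbset X)) : ~ perp F (pf_point p) ->
  exists q, ~ perp q p /\ ortho (ortho [set F]) (pf_point q).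
Proof.
move=> Fp; pose D := [set UV : cbset X * cbset X | F UV.1 /\ ortho UV.2 p].
have [||[U V] [/= FU pV]|[U V] [U' V'] [/= FU pV] [/= FU' pV']|q qP] :=
    @compact_directed X _ D (fun UV => cb_set UV.1 `&` ~` cb_set UV.2).
- exact: os_compact.
- by exists (\top, \bot); split; [exact: pf_top|move=> x []].
- have [[[_ cU] _] [[oV _] _]] := (cbP U, cbP V); split.
    by apply: closedI => //; exact: open_closedC.
  apply: contrapT => UV0; apply: Fp; apply/pf_perpP; exists U => //.
  apply: orthoS pV => x Ux; apply: contrapT => Vx.
  by apply: UV0; exists x.
- exists ((U `&` U')%O, (V `|` V')%O).
    split; first exact: pf_meet.
    by apply: sub_biortho; rewrite orthoU.
  move=> x [[Ux U'x] VV'x].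
  by do 2!split=> //; move=> Vx; apply: VV'x; apply: sub_biortho; [left|right].
- exists q; split.
    move=> /os_perp[V [cV Vq pV]].
    have [|_] := qP (\top, CBSet cV); first by split; [exact: pf_top|].
    exact.
  rewrite biortho_pf => U FU.
  (* The choice V = \bot leaves the bare membership of q in U. *)
  have [|//] := qP (U, \bot).
  by split=> // x [].
Qed.

End Points.

Section Counit.
Context d (X : monadicOrthospaceType d).

Lemma pf_point_mos : is_mos_morphism (@pf_point _ X).
Proof.
split; first split.
- exact: pf_point_continuous.
- by move=> p q /pf_perpP[U Up Uq]; exact: Uq.
- by move=> p F; exact: pf_point_lift.
- move=> ?; rewrite clopen_biorthoE => -[U _ <-].
  by rewrite rel_image_pf_basic !preimage_pf_point -cb_mexE.
Qed.

Definition eps : mos_hom X (pfilter (cbset X)) := MosHom pf_point_mos.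

End Counit.

Theorem theorem5p8 : left_adjoint filter_functor clopen_functor.
Proof.
exists (fun (L : mol_obj) (X : mos_obj) (u : mos_hom X (pfilter L)) =>
  mol_comp (cb_mol_hom u) (eta L)).
split=> [L X|L X Y g u|L M X f u].
- exists (fun f : mol_hom L (cbset X) => mos_comp (pf_mos_hom f) (eps X)).
    by move=> u; apply: mos_hom_eq => x; exact: pfilter_eq.
  by move=> f; apply: mol_hom_eq => a; exact: cbset_eq.
- by apply: mol_hom_eq => a; exact: cbset_eq.
- by apply: mol_hom_eq => a; exact: cbset_eq.
Qed.
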